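(* Let $\mathcal{K}_0\subseteq\mathbb{R}^{n_1}$ be a nonempty closed convex cone, let $\mathcal{K}_i\in\{\mathbb{R}^{n_2}_+,\mathbb{R}^{n_2}\}$ for every $i\in[1:S]$, and $\bar{\mathcal{K}}:=(\mathcal{K}_0,\dots,\mathcal{K}_S)$. Then $\mathcal{DDC}(\bar{\mathcal{K}})\subseteq\mathcal{CMP}(\bar{\mathcal{K}})$.
   Context: Notation: $[1:S]=\{1,\dots,S\}$; $e_k$ is the $k$-th unit vector; $O$ is a zero matrix. For a closed convex cone $\mathcal{K}\subseteq\mathbb{R}^m$ the set-completely positive cone is $\mathcal{CPP}(\mathcal{K}):=\{\sum_{l=1}^{p}x_lx_l^{\mathsf T} : x_l\in\mathcal{K},\ p\in\mathbb{N}\}$. $[M_i]_{i\in[1:S]}$ denotes an $S$-tuple of symmetric $(n_1+n_2)\times(n_1+n_2)$ matrices $M_i=\begin{pmatrix}X&Z_i^{\mathsf T}\\ Z_i&Y_i\end{pmatrix}$ sharing the same upper-left $n_1\times n_1$ block $X$ (with $Z_i\in\mathbb{R}^{n_2\times n_1}$); such tuples form a vector space $\mathcal{S}^{S,n_1}_{n_1+n_2}$ with componentwise operations. In this space, $$\mathcal{CMP}(\bar{\mathcal{K}}):=\operatorname{conv}\left\{\left[\begin{pmatrix}x\\ y_i\end{pmatrix}\begin{pmatrix}x\\ y_i\end{pmatrix}^{\mathsf T}\right]_{i\in[1:S]} : x\in\mathcal{K}_0,\ y_i\in\mathcal{K}_i,\ i\in[1:S]\right\}.$$ For $k\in[1:n_2]$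 and $s\in[1:S]$, $\mathcal{DDC}_{k,s}(\bar{\mathcal{K}})$ is the set of all $\left[\begin{pmatrix}X&Z_i^{\mathsf T}\\ Z_i&Y_i\end{pmatrix}\right]_{i\in[1:S]}$ for which there are $z\in\mathbb{R}^{n_1}$ and $y\in\mathbb{R}$ with $$\begin{pmatrix}X&z\\ z^{\mathsf T}&y\end{pmatrix}\in\mathcal{CPP}(\mathcal{K}_0\times\mathbb{R}_+),\quad Z_s^{\mathsf T}=z\,e_k^{\mathsf T},\quad Y_s=y\,e_ke_k^{\mathsf T},\quad Y_i=O,\ Z_i=O\ \text{ for } i\in[1:S]\setminus\{s\}$$ (here $e_k\in\mathbb{R}^{n_2}$), and $\mathcal{DDC}(\bar{\mathcal{K}}):=\sum_{s=1}^{S}\sum_{k=1}^{n_2}\mathcal{DDC}_{k,s}(\bar{\mathcal{K}})$ (Minkowski sum). *)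

(* Defs.v *)
(* MathComp / MathComp-Analysis. *)
From HB Require Import structures.
From mathcomp Require Import all_boot all_order all_algebra.
From mathcomp Require Import all_classical all_reals all_analysis.

Set Implicit Arguments.
Unset Strict Implicit.
Unset Printing Implicit Defensive.

Import Order.TTheory GRing.Theory Num.Theory.
Import numFieldNormedType.Exports.

Local Open Scope classical_set_scope.
Local Open Scope ring_scope.

Section Cones.
Context {R : realType}.

(* Only positive scalings are required: for a nonempty closed set this is
   equivalent to closure under nonnegative scalings. *)
Definition closed_convex_cone (m : nat) (K : set 'cV[R]_m) : Prop :=
  [/\ closed K, convex_set (M := 'cV[R]_m) K
    & forall (t : R) (x : 'cV[R]_m), 0 < t -> K x -> K (t *: x)].

Definition nonneg_orthant (m : nat) : set 'cV[R]_m :=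
  [set x | forall j, 0 <= x j 0].

Definition prod_set (m1 m2 : nat) (K : set 'cV[R]_m1) (L : set 'cV[R]_m2) :
    set 'cV[R]_(m1 + m2) :=
  [set v | K (usubmx v) /\ L (dsubmx v)].

Definition CPP (m : nat) (K : set 'cV[R]_m) : set 'M[R]_m :=
  [set A | exists (p : nat) (x : 'I_p -> 'cV[R]_m),
     (forall l, K (x l)) /\ A = \sum_(l < p) x l *m (x l)^T].

Definition conv_hull (V : lmodType R) (A : set V) : set V :=
  smallest (@convex_set R V) A.

Definition unit_vec (m : nat) (k : 'I_m) : 'cV[R]_m := delta_mx k 0.

End Cones.

Section SharedBlockTuples.
Context {R : realType} {S n1 n2 : nat}.

(* The ambient space of S-tuples; [shared_space] below is the subspace of
   tuples of symmetric matrices with a common upper-left block. *)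
Definition mx_tuple := {ffun 'I_S -> 'M[R]_(n1 + n2)}.

Definition block_tuple (X : 'M[R]_n1) (Z : 'I_S -> 'M[R]_(n2, n1))
    (Y : 'I_S -> 'M[R]_n2) : mx_tuple :=
  [ffun i => block_mx X (Z i)^T (Z i) (Y i)].

Definition shared_space : set mx_tuple :=
  [set M | exists X Z Y, [/\ X^T = X, forall i, (Y i)^T = Y i
                           & M = block_tuple X Z Y]].

(* (K_0, (K_1, ..., K_S)); the index i : 'I_S stands for i.+1. *)
Definition cone_tuple : Type :=
  (set 'cV[R]_n1 * ('I_S -> set 'cV[R]_n2))%type.

Definition rank1_tuple (x : 'cV[R]_n1) (y : 'I_S -> 'cV[R]_n2) : mx_tuple :=
  [ffun i => col_mx x (y i) *m (col_mx x (y i))^T].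

(* The hull is taken in the ambient space, which amounts to taking it in
   [shared_space]: see [CMP_shared_space]. *)
Definition CMP (Kbar : cone_tuple) : set mx_tuple :=
  conv_hull [set M | exists x y,
    [/\ Kbar.1 x, forall i, Kbar.2 i (y i) & M = rank1_tuple x y]].

Definition DDC_part (Kbar : cone_tuple) (k : 'I_n2) (s : 'I_S) :
    set mx_tuple :=
  [set M | shared_space M /\
    exists X Z Y, M = block_tuple X Z Y /\
    exists (z : 'cV[R]_n1) (y : R),
    [/\ CPP (prod_set Kbar.1 (nonneg_orthant (m := 1)))
          (block_mx X z z^T y%:M),
        (Z s)^T = z *m (unit_vec k)^T,
        Y s = y *: (unit_vec k *m (unit_vec k)^T)
      & forall i, i != s -> Y i = 0 /\ Z i = 0]].

Definition DDC (Kbar : cone_tuple) : set mx_tuple :=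
  [set M | exists D : 'I_S -> 'I_n2 -> mx_tuple,
    (forall s k, DDC_part Kbar k s (D s k)) /\
    M = \sum_(s < S) \sum_(k < n2) D s k].

Lemma block_tupleD X Z Y X' Z' Y' :
  block_tuple X Z Y + block_tuple X' Z' Y' =
  block_tuple (X + X') (fun i => Z i + Z' i) (fun i => Y i + Y' i).
Proof. by apply/ffunP => i; rewrite !ffunE add_block_mx linearD. Qed.

Lemma block_tupleZ (a : R) X Z Y :
  a *: block_tuple X Z Y =
  block_tuple (a *: X) (fun i => a *: Z i) (fun i => a *: Y i).
Proof. by apply/ffunP => i; rewrite !ffunE scale_block_mx linearZ. Qed.

Lemma shared_spaceD M N :
  shared_space M -> shared_space N -> shared_space (M + N).
Proof.
move=> [X [Z [Y [sX sY ->]]]] [X' [Z' [Y' [sX' sY' ->]]]].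
rewrite block_tupleD; do 3 eexists; split; last reflexivity.
  by rewrite linearD /= sX sX'.
by move=> i; rewrite linearD /= sY sY'.
Qed.

Lemma shared_spaceZ (a : R) M : shared_space M -> shared_space (a *: M).
Proof.
move=> [X [Z [Y [sX sY ->]]]].
rewrite block_tupleZ; do 3 eexists; split; last reflexivity.
  by rewrite linearZ /= sX.
by move=> i; rewrite linearZ /= sY.
Qed.

Lemma CMP_shared_space (Kbar : cone_tuple) : CMP Kbar `<=` shared_space.
Proof.
apply: smallest_sub.
  move=> M N t; rewrite !inE => hM hN.
  by apply: shared_spaceD; apply: shared_spaceZ.
move=> _ [x [y [_ _ ->]]].
exists (x *m x^T), (fun i => y i *m x^T), (fun i => y i *m (y i)^T); split.
- by rewrite trmx_mul trmxK.
- by move=> i; rewrite trmx_mul trmxK.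
- apply/ffunP => i.
  by rewrite !ffunE tr_col_mx mul_col_row trmx_mul trmxK.
Qed.

End SharedBlockTuples.

(* Main.v *)
(* Writing a witness of DDC_{k,s} as a sum over l of (x_l, t_l)(x_l, t_l)^T with
   t_l >= 0, the tuple is the sum over l of the rank-one tuples with x = x_l,
   y_s = t_l e_k and y_i = 0 for i != s.  It remains that CMP is closed under
   sums: the generators are stable under positive scaling (by square roots),
   so M + N is the midpoint of 2M and 2N. *)
Require Import Defs.
From mathcomp Require Import all_boot all_order all_algebra.
From mathcomp Require Import all_classical all_reals all_analysis.
From mathcomp Require Import lra.
Import numFieldNormedType.Exports.
Local Open Scope classical_set_scope.
Local Open Scope ring_scope.

Import Order.TTheory GRing.Theory Num.Theory.

(** For any convex [B] containing [A], the preimage of [B] under scaling by [a] is again convex and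
    contains [A], hence contains the hull. *)
Lemma conv_hullZ (R : realType) (V : lmodType R) (A : set V) (a : R) :
  (forall v, A v -> A (a *: v)) ->
  forall v, conv_hull A v -> conv_hull A (a *: v).
Proof.
move=> AZ v Av B [cB AB].
apply: (Av [set w | B (a *: w)]); split => [x y t|w /AZ /AB //].
rewrite !inE /= => Bx By.
have := cB _ _ t (mem_set Bx) (mem_set By); rewrite inE.
congr (B _); rewrite [RHS]scalerDr.
by congr (_ + _); rewrite scalerA [RHS]scalerA mulrC.
Qed.

Lemma conv_hullD (R : realType) (V : lmodType R) (A : set V) :
  (forall (a : R) v, 0 < a -> A v -> A (a *: v)) ->
  forall u v, conv_hull A u -> conv_hull A v -> conv_hull A (u + v).
Proof.
move=> AZ u v Au Av.
have hA w : conv_hull A w -> conv_hull A (2 *: w).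
  by apply: conv_hullZ => ?; apply: AZ.
move=> B BP; have [cB _] := BP.
have h0 : 0 <= 2^-1 :> R by lra.
have h1 : 2^-1 <= 1 :> R by lra.
have /set_mem :=
  cB _ _ (Itv01 h0 h1) (mem_set (hA _ Au B BP)) (mem_set (hA _ Av B BP)).
congr (B _); congr (_ + _) => /=.
  by rewrite scalerA mulVf ?scale1r // pnatr_eq0.
have half : (1 - 2^-1) * 2 = 1 :> R by lra.
by rewrite scalerA half scale1r.
Qed.

(** Scaling is assumed for positive factors only, so 0 is reached as the limit of x/(n+1) for some x
    in [K], by closedness. *)
Lemma closed_cone0 (R : realType) (m : nat) (K : set 'cV[R]_m) :
  K !=set0 -> closed_convex_cone K -> K 0.
Proof.
move=> [x Kx] [Kcl _ KZ].
apply: (closed_cvg (F := \oo) (u_ := fun n => @harmonic R n *: x) _ Kcl);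
  last first.
  by rewrite -(scale0r x); apply: cvgZr_tmp; exact: cvg_harmonic.
by apply: nearW => n; apply: KZ => //; exact: harmonic_gt0.
Qed.

Lemma rank1_tupleZ (R : realType) (S n1 n2 : nat) (a : R) (x : 'cV[R]_n1)
    (y : 'I_S -> 'cV[R]_n2) : 0 <= a ->
  a *: rank1_tuple x y =
  rank1_tuple (Num.sqrt a *: x) (fun i => Num.sqrt a *: y i).
Proof.
move=> a0; apply/ffunP => i; rewrite !ffunE -scale_col_mx linearZ /=.
by rewrite -scalemxAl -scalemxAr scalerA -expr2 sqr_sqrtr.
Qed.

Lemma rank1_tuple_block (R : realType) (S n1 n2 : nat) (x : 'cV[R]_n1)
    (y : 'I_S -> 'cV[R]_n2) :
  rank1_tuple x y =
  block_tuple (x *m x^T) (fun i => y i *m x^T) (fun i => y i *m (y i)^T).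
Proof.
apply/ffunP => i.
by rewrite !ffunE tr_col_mx mul_col_row trmx_mul trmxK.
Qed.

Lemma sum_block_mx (V : nmodType) (m1 m2 n1 n2 : nat) (I : Type) (r : seq I)
    (P : pred I) (A : I -> 'M[V]_(m1, n1)) (B : I -> 'M[V]_(m1, n2))
    (C : I -> 'M[V]_(m2, n1)) (D : I -> 'M[V]_(m2, n2)) :
  \sum_(i <- r | P i) block_mx (A i) (B i) (C i) (D i) =
  block_mx (\sum_(i <- r | P i) A i) (\sum_(i <- r | P i) B i)
           (\sum_(i <- r | P i) C i) (\sum_(i <- r | P i) D i).
Proof.
elim: r => [|i r IHr]; first by rewrite !big_nil block_mx0.
by rewrite !big_cons; case: ifP => _; rewrite IHr ?add_block_mx.
Qed.

Section CMPCone.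
Context {R : realType} {S n1 n2 : nat}.
Variables (K0 : set 'cV[R]_n1) (K : 'I_S -> set 'cV[R]_n2).
Hypotheses (K0_neq0 : K0 !=set0) (K0_cone : closed_convex_cone K0).
Hypothesis K_cone : forall i, K i = @nonneg_orthant R n2 \/ K i = setT.

Let KZ i (a : R) y : 0 <= a -> K i y -> K i (a *: y).
Proof.
by case: (K_cone i) => -> // a0 y0 j; rewrite mxE mulr_ge0 ?y0.
Qed.

(** Places both 0 and t e_k with t >= 0 in [K i], whichever of its two forms it takes. *)
Let K_nonneg i y : nonneg_orthant y -> K i y.
Proof. by case: (K_cone i) => ->. Qed.

Lemma CMP_rank1 x y : K0 x -> (forall i, K i (y i)) ->
  CMP (K0, K) (rank1_tuple x y).
Proof. by move=> Kx Ky; apply: sub_gen_smallest; exists x, y. Qed.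

(** Base case for sums in [CMP_sum], which may be empty: 0 is the rank-one tuple of zero vectors. *)
Lemma CMP0 : CMP (K0, K) 0.
Proof.
have -> : 0 = rank1_tuple (0 : 'cV[R]_n1) (fun _ : 'I_S => (0 : 'cV[R]_n2)).
  by apply/ffunP => i; rewrite !ffunE col_mx0 mul0mx.
apply: CMP_rank1; first exact: closed_cone0.
by move=> i; apply: K_nonneg => j; rewrite mxE.
Qed.

Lemma CMPD M N : CMP (K0, K) M -> CMP (K0, K) N -> CMP (K0, K) (M + N).
Proof.
apply: conv_hullD => a _ a0 [x [y [/= Kx Ky ->]]].
exists (Num.sqrt a *: x), (fun i => Num.sqrt a *: y i); split.
(* Here a > 0 is used strictly, since [K0] is only known to absorb positive factors. *)
- by case: K0_cone => _ _; apply=> //; rewrite sqrtr_gt0.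
- by move=> i; apply: KZ; rewrite ?sqrtr_ge0.
- exact/rank1_tupleZ/ltW.
Qed.

Lemma CMP_sum (I : Type) (r : seq I) (P : pred I) (F : I -> mx_tuple) :
  (forall i, P i -> CMP (K0, K) (F i)) ->
  CMP (K0, K) (\sum_(i <- r | P i) F i).
Proof. by move=> FC; apply: big_ind => //; [exact: CMP0|exact: CMPD]. Qed.

Lemma DDC_part_sub_CMP k s : DDC_part (K0, K) k s `<=` CMP (K0, K).
Proof.
move=> _ [_ [X [Z [Y [-> [z [y [[p [v [vK]]]]]]]]]]].
(* Split [v l] into x_l = [usubmx (v l)] and the 1x1 block t_l = [dsubmx (v l)], so that X, z and y
   can be read off block by block. *)
have -> : \sum_(l < p) v l *m (v l)^T =
    block_mx (\sum_l usubmx (v l) *m (usubmx (v l))^T)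
             (\sum_l usubmx (v l) *m (dsubmx (v l))^T)
             (\sum_l dsubmx (v l) *m (usubmx (v l))^T)
             (\sum_l dsubmx (v l) *m (dsubmx (v l))^T).
  rewrite -sum_block_mx; apply: eq_bigr => l _.
  by rewrite -mul_col_row -tr_col_mx vsubmxK.
move=> /eq_block_mx [XE _ zE yE] ZE YE YZ0.
pose w l i : 'cV[R]_n2 := if i == s then dsubmx (v l) 0 0 *: unit_vec k else 0.
suff -> : block_tuple X Z Y = \sum_(l < p) rank1_tuple (usubmx (v l)) (w l).
  apply: CMP_sum => l _; have [Kx Kt] := vK l.
  apply: CMP_rank1 => // i; apply: K_nonneg => j.
  (* Nonnegative entries: t_l >= 0 by [Kt], and e_k has entries 0 and 1. *)
  rewrite /w; case: ifP => _; last by rewrite mxE.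
  by rewrite mxE mulr_ge0 // mxE ler0n.
have dE l : dsubmx (v l) = (dsubmx (v l) 0 0)%:M by exact: mx11_scalar.
have ZsE : Z s = unit_vec k *m z^T by rewrite -[LHS]trmxK ZE trmx_mul trmxK.
(* At i = s this is e_k z^T with z^T = sum of t_l x_l^T; elsewhere both sides vanish. *)
have {}ZE i : Z i = \sum_l w l i *m (usubmx (v l))^T.
  rewrite /w; have [->|/YZ0[_ ->]] := eqVneq i s; last first.
    by rewrite big1 // => l _; rewrite mul0mx.
  rewrite ZsE zE mulmx_sumr; apply: eq_bigr => l _.
  by rewrite {1}dE mul_scalar_mx -scalemxAr scalemxAl.
have {}YE i : Y i = \sum_l w l i *m (w l i)^T.
  rewrite /w; have [->|/YZ0[-> _]] := eqVneq i s; last first.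
    by rewrite big1 // => l _; rewrite mul0mx.
  (* The lower-right block gives y as the sum of t_l^2, matching (t_l e_k)(t_l e_k)^T = t_l^2 e_k
     e_k^T. *)
  rewrite YE; have -> : y = \sum_l dsubmx (v l) 0 0 ^+ 2.
    move/matrixP/(_ 0 0): yE; rewrite mxE eqxx mulr1n => ->.
    by rewrite summxE; apply: eq_bigr => l _; rewrite mxE big_ord1 [_^T _ _]mxE.
  rewrite scaler_suml; apply: eq_bigr => l _.
  by rewrite linearZ /= -scalemxAl -scalemxAr scalerA expr2.
(* All blocks are now sums over the same l; [linear_sum] moves the transpose of the upper-right
   block inside its sum. *)
apply/ffunP => i; rewrite sum_ffunE ffunE XE ZE YE linear_sum /= -sum_block_mx.
apply: eq_bigr => l _; rewrite rank1_tuple_block ffunE; congr block_mx.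
Qed.

End CMPCone.

Theorem theorem13 (R : realType) (S n1 n2 : nat)
    (K0 : set 'cV[R]_n1) (K : 'I_S -> set 'cV[R]_n2)
    (K0_neq0 : K0 !=set0) (K0_cone : closed_convex_cone K0)
    (K_cone : forall i, K i = @nonneg_orthant R n2 \/ K i = setT) :
  DDC (K0, K) `<=` CMP (K0, K).
Proof.
move=> _ [D [DP ->]].
apply: CMP_sum => // s _; apply: CMP_sum => // k _.
exact: DDC_part_sub_CMP (DP s k).
Qed.
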